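(* Let $\beta\in B_n$ be a braid with exponent sum $w$ and Laurent MFW polynomials $h_0,\dots,h_{n-1}$. With $f_j=h_j$ the following two relations hold: $$\text{(A)}\quad \sum_{j=0}^{n-1}C_{2j-3}\,f_j=C_{4+w-n},\qquad \text{(B)}\quad \sum_{j=0}^{n-1}C_{2j-1}\,f_j=C_{2+w-n}.$$ For $n>1$ these relations are independent: for a fixed choice of $w$ and $n$, a family $\{f_j\}_{j=0}^{n-1}$ of functions of $z$ can satisfy one of (A), (B) and not satisfy the other (there is a family satisfying (A) but not (B), and a family satisfying (B) but not (A)). Moreover, any family of $n$ functions $\{f_j\}_{j=0}^{n-1}$ of $z$ that satisfies both (A) and (B) also satisfies, for each integer $\kappa$, $$\sum_{j=0}^{n-1}C_{2j-1-\kappa}\,f_j=(-1)^{\kappa}\,C_{\kappa+2+w-n}.$$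
   Context: $B_n$ is the braid group on $n$ strands with standard generators $\sigma_1,\dots,\sigma_{n-1}$; $\widehat\beta$ is the oriented link obtained by the standard closure of $\beta$; $w=w(\beta)$ is the exponent sum (writhe) of $\beta$. The Homflypt polynomial $P_L(v,z)$ of an oriented link $L$ is determined by $P=1$ on the unknot and $P_{D_+}=vz\,P_{D_0}+v^2P_{D_-}$ for diagrams differing at one crossing (positive, smoothed, negative). The Conway polynomial is $\nabla_L(z)=P_L(1,z)$. For every integer $p$, $C_p=C_p(z)$ is the Conway polynomial of the closure of $\sigma_1^p\in B_2$; equivalently $C_0=0$, $C_1=1$, $C_{p+1}=zC_p+C_{p-1}$ for all $p\in\mathbb Z$. For $\beta\in B_n$ one can write uniquely $P_{\widehat\beta}(v,z)=v^{w-n+1}\sum_{j=0}^{n-1}h_j(z)v^{2j}$ with $h_j\in\mathbb Z[z,z^{-1}]$ (a consequence of the Morton-Franks-Williams inequality); the $h_j$ (possibly zero) are the Laurent MFW polynomials of $\beta$. ''Functions of $z$'' are functions of the nonzero variable $z$ (division by $z$ is allowed), e.g. Laurent polynomials or rational functions. *)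

(* Defs.v *)
From HB Require Import structures.
From Stdlib Require Import Relations.
From mathcomp Require Import all_boot all_order all_algebra.
From mathcomp Require Import fraction.

Set Implicit Arguments.
Unset Strict Implicit.
Unset Printing Implicit Defensive.

Import Order.TTheory GRing.Theory Num.Theory.
Local Open Scope ring_scope.

(** * Oriented link diagrams in the plane

   A diagram in general position with respect to the height function is cut
   into horizontal layers, each containing one minimum ([Cup]), one maximum
   ([Cap]) or one crossing ([Cross]).  A layer [(i, e)] performs [e] to the
   right of the first [i] strands; a diagram lists its layers from bottom to
   top.  A horizontal slice is the list of its strand orientations from left
   to right, [true] for upwards.

   [Cup b]   : minimum whose left branch has orientation [b].
   [Cross c] : [c = true] iff the strand running from bottom left to top right
               is the overpass; as only this geometric picture is recorded,
               the sign of the crossing also depends on the orientations. *)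
Inductive event := Cup of bool | Cap | Cross of bool.

Definition layer := (nat * event)%type.
Definition slice := seq bool.

Definition run1 (l : layer) (s : slice) : option slice :=
  let: (i, e) := l in
  match e with
  | Cup b =>
      if (i <= size s)%N then Some (take i s ++ [:: b; ~~ b] ++ drop i s)
      else None
  | Cap =>
      if (i.+1 < size s)%N && (nth false s i != nth false s i.+1)
      then Some (take i s ++ drop i.+2 s) else None
  | Cross _ =>
      if (i.+1 < size s)%N
      then Some (take i s ++ [:: nth false s i.+1; nth false s i]
                          ++ drop i.+2 s)
      else None
  end.

Fixpoint run (d : seq layer) (s : slice) : option slice :=
  if d is l :: d' then obind (run d') (run1 l s) else Some s.

Definition link_diagram (d : seq layer) : Prop := run d [::] = Some [::].

Definition width_in (e : event) : nat := if e is Cup _ then 0 else 2.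
Definition width_out (e : event) : nat := if e is Cap then 0 else 2.

(** Turaev's, Freyd and Yetter's presentation of isotopy for diagrams cut into
   layers: the first five moves generate planar isotopy, the last four
   are the Reidemeister moves. *)
Inductive local_move : seq layer -> seq layer -> Prop :=
| move_exchange i k x y :
    local_move [:: (i, x); (i + width_out x + k, y)%N]
               [:: (i + width_in x + k, y)%N; (i, x)]
| move_zigzag_left i b :
    local_move [:: (i, Cup b); (i.+1, Cap)] [::]
| move_zigzag_right i b :
    local_move [:: (i.+1, Cup b); (i, Cap)] [::]
| move_slide_cup i b c :
    local_move [:: (i, Cup b); (i.+1, Cross c)]
               [:: (i.+1, Cup b); (i, Cross (~~ c))]
| move_slide_cap i c :
    local_move [:: (i.+1, Cross c); (i, Cap)]
               [:: (i, Cross (~~ c)); (i.+1, Cap)]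
| move_R1_cup i b c :
    local_move [:: (i, Cup b); (i, Cross c)] [:: (i, Cup (~~ b))]
| move_R1_cap i c :
    local_move [:: (i, Cross c); (i, Cap)] [:: (i, Cap)]
| move_R2 i c :
    local_move [:: (i, Cross c); (i, Cross (~~ c))] [::]
(* [c1], [c2], [c3] compare the strands 1-2, 1-3, 2-3; the side condition says
   that these comparisons order the three strands by height. *)
| move_R3 i c1 c2 c3 of (c1 == c2) || (c2 == c3) :
    local_move [:: (i, Cross c1); (i.+1, Cross c2); (i, Cross c3)]
               [:: (i.+1, Cross c3); (i, Cross c2); (i.+1, Cross c1)].

Inductive diagram_move : seq layer -> seq layer -> Prop :=
| DiagramMove d1 d2 a b of
    local_move a b & link_diagram (d1 ++ a ++ d2)
    & link_diagram (d1 ++ b ++ d2) :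
    diagram_move (d1 ++ a ++ d2) (d1 ++ b ++ d2).

(** Two link diagrams represent the same oriented link. *)
Definition isotopic : seq layer -> seq layer -> Prop :=
  clos_refl_sym_trans _ diagram_move.

Definition circle : seq layer := [:: (0%N, Cup true); (0%N, Cap)].

(** * Braids and their closures *)

(** Words in the generators of the braid group on [n] strands: [(i, true)] is
   sigma_(i+1) and [(i, false)] its inverse.  Every braid is given by a word,
   and the closure and the exponent sum do not depend on the word chosen. *)
Definition braid_word (n : nat) := seq ('I_n.-1 * bool).

Definition exponent_sum n (beta : braid_word n) : int :=
  \sum_(x <- beta) (if x.2 then 1 else -1).

(** The braid strands run upwards on the left and return on the right through
   [n] nested arcs. *)
Definition braid_closure n (beta : braid_word n) : seq layer :=
  [seq (k, Cup true) | k <- iota 0 n]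
  ++ [seq (val x.1, Cross x.2) | x <- beta]
  ++ [seq (k, Cap) | k <- rev (iota 0 n)].

(** * The Homflypt polynomial *)

(** Laurent polynomials are taken inside the fields Q(z) and Q(z)(v). *)
Definition Qz := {fraction {poly int}}.
Definition Qzv := {fraction {poly Qz}}.

Definition zz : Qz := tofrac 'X.
Definition of_Qz (a : Qz) : Qzv := tofrac a%:P.
Definition vv : Qzv := tofrac 'X.

(** Smoothing, in accordance with the orientations, of a crossing at position
   [i] above the slice [s]: a vertical one for parallel strands, a horizontal
   one for antiparallel strands. *)
Definition smoothing (s : slice) (i : nat) : seq layer :=
  if nth false s i == nth false s i.+1 then [::]
  else [:: (i, Cap); (i, Cup (nth false s i.+1))].

(** The value of [c] for which [(i, Cross c)] is positive above [s]. *)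
Definition positive_type (s : slice) (i : nat) : bool :=
  nth false s i == nth false s i.+1.

(** [P] is unconstrained on lists that are not link diagrams. *)
Record homflypt (P : seq layer -> Qzv) : Prop := Homflypt {
  homflypt_isotopy : forall d d', link_diagram d -> link_diagram d' ->
    isotopic d d' -> P d = P d';
  homflypt_unknot : P circle = 1;
  homflypt_skein : forall d1 d2 s i,
    run d1 [::] = Some s ->
    let: c := positive_type s i in
    link_diagram (d1 ++ [:: (i, Cross c)] ++ d2) ->
    P (d1 ++ [:: (i, Cross c)] ++ d2) =
      vv * of_Qz zz * P (d1 ++ smoothing s i ++ d2)
      + vv ^+ 2 * P (d1 ++ [:: (i, Cross (~~ c))] ++ d2)
}.

Definition is_laurent (a : Qz) : Prop :=
  exists (p : {poly int}) (m : nat), a = tofrac p / zz ^+ m.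

(** [h] is the family of Laurent MFW polynomials of [beta]. *)
Definition laurent_MFW (P : seq layer -> Qzv) n (beta : braid_word n)
    (h : 'I_n -> Qz) : Prop :=
  (forall j, is_laurent (h j)) /\
  P (braid_closure beta) =
    vv ^ (exponent_sum beta - n%:Z + 1)
    * \sum_(j < n) of_Qz (h j) * vv ^+ (2 * j).

(** * The Conway polynomials of the closures of the 2-braids sigma_1^p *)

(** The iterated pair is (C_p, C_(p+1)), starting from (C_0, C_1) = (0, 1). *)
Definition conwayC (A : comUnitRingType) (z : A) (p : int) : A :=
  match p with
  | Posz k => (iter k (fun x => (x.2, z * x.2 + x.1)) (0, 1)).1
  | Negz k => (iter k.+1 (fun x => (x.2 - z * x.1, x.1)) (0, 1)).1
  end.

(** [A] is any ring of functions of [z]: Laurent polynomials, rational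
   functions, or, pointwise, a field of values with [z] one of its elements. *)
Section Relations.
Variables (A : comUnitRingType) (z : A) (n : nat) (w : int) (f : 'I_n -> A).

Definition relA : Prop :=
  \sum_(j < n) conwayC z ((2 * j)%:Z - 3) * f j = conwayC z (4 + w - n%:Z).

Definition relB : Prop :=
  \sum_(j < n) conwayC z ((2 * j)%:Z - 1) * f j = conwayC z (2 + w - n%:Z).

Definition relK (kappa : int) : Prop :=
  \sum_(j < n) conwayC z ((2 * j)%:Z - 1 - kappa) * f j =
    (-1) ^ kappa * conwayC z (kappa + 2 + w - n%:Z).

End Relations.

Lemma conwayC0 (A : comUnitRingType) (z : A) : conwayC z 0 = 0.
Proof. by []. Qed.

Lemma conwayC1 (A : comUnitRingType) (z : A) : conwayC z 1 = 1.
Proof. by []. Qed.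

Lemma conwayC_rec (A : comUnitRingType) (z : A) (p : int) :
  conwayC z (p + 1) = z * conwayC z p + conwayC z (p - 1).
Proof.
case: p => [[|k]|k].
- by rewrite add0r /conwayC /= !mulr0 subr0 add0r.
- have -> : Posz k.+1 + 1 = Posz k.+2 by rewrite -PoszD addn1.
  by have -> : Posz k.+1 - 1 = Posz k by rewrite -[k.+1]addn1 PoszD addrK.
have -> : Negz k - 1 = Negz k.+1.
  by rewrite !NegzE -[k.+2]addn1 PoszD opprD.
case: k => [|k].
  by rewrite NegzE addNr /conwayC /= !(mulr0, subr0, mulr1, sub0r, subrr).
have -> : Negz k.+1 + 1 = Negz k.
  by rewrite !NegzE -[k.+2]addn1 PoszD opprD addrK.
rewrite /conwayC (iterS k.+2) (iterS k.+1).
by case: (iter k.+1 _ _) => a b /=; rewrite addrC subrK.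
Qed.

(* Main.v *)
Require Import Defs.
From Stdlib Require Import Relations.
From mathcomp Require Import all_boot all_order all_algebra.
From mathcomp Require Import fraction ring zify.

Set Implicit Arguments.
Unset Strict Implicit.
Unset Printing Implicit Defensive.

Import Order.TTheory GRing.Theory Num.Theory.
Local Open Scope ring_scope.

(** Write [C_p] for the Conway polynomials and let [u = 1/v] be a root of
   [u^2 = 1 + z u].  Then [u^p = C_p u + C_(p-1)] for every integer [p], so a
   linear relation between powers of [u] is the same thing as a family of
   linear relations between Conway polynomials.

   The root is chosen so that the skein relation degenerates.  In terms of [v]
   the equation is [v^2 + z v - 1 = 0], that is [v z + v^2 = 1]: the three
   Homflypt polynomials of a skein triple are then related by an affine
   combination, with all coefficients invertible, and if two of them have the
   value 1 at the root, so has the third.  As the unknot has the value 1, so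
   does every closed braid ([homflypt_closure_at_root]), which says that
   [v^(w-n+1) (sum_j h_j v^(2j))] is congruent to 1 modulo [v^2 + z v - 1].
   Applying the linear form that sends [v^i] to [C_(c-i)], which kills the
   multiples of [v^2 + z v - 1] by the Conway recurrence, gives
   [sum_j C_(c-2j) h_j = C_(c+w-n+1)] for all [c] ([laurent_MFW_conway]); since
   [C_(-p) = C_p] for odd [p], the values [c = 3] and [c = 1] are (A) and (B).

   That closed braids can be reached from the unknot by skein triples, two
   members at a time, is an induction on the number of strands, then on the
   length of the word.  When all shorter words are settled, the smoothing of a
   crossing is settled, so the signs of the crossings may be chosen at will: the
   word becomes a word in the Coxeter generators of the symmetric group.  Such
   a word can be rewritten by braid relations until it contains a square, which
   a change of sign cancels, or contains the last generator at most once
   ([braid_equiv_reduce]).  A single occurrence of the last generator is removed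
   by an isotopy that lowers the number of strands ([stabilization]); if there
   is no occurrence, the word is the smoothing of two words with one occurrence.

   The other two claims are algebra.  Both sides of the third relation satisfy
   the same second order recurrence in [kappa]; (B) and (A) are the cases
   [kappa = 0] and [kappa = 2], and [kappa = 1] follows because [z] is
   invertible.  For the independence, the left-hand sides of (A) and (B)
   restricted to [f_0], [f_1] have determinant [z^2], so they take arbitrary
   values. *)

(** * Sequences satisfying the Conway recurrence *)

Lemma recurrence_eq0 (A : pzRingType) (z : A) (F : int -> A) :
  (forall p, F (p + 1) = z * F p + F (p - 1)) ->
  F 0 = 0 -> F 1 = 0 -> forall p, F p = 0.
Proof.
move=> recF F0 F1 p.
suff: F p = 0 /\ F (p + 1) = 0 by case.
elim/int_rect: p => [|k [IH0 IH1]|k [IH0 IH1]]; first by rewrite add0r.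
  rewrite -[k.+1]addn1 PoszD; split=> //.
  by rewrite recF IH1 addrK IH0 mulr0 addr0.
have eq_k : - k.+1%:Z + 1 = - k%:Z by rewrite -[k.+1]addn1 PoszD; lia.
rewrite eq_k; split=> //.
have -> : - k.+1%:Z = - k%:Z - 1 by lia.
by have := recF (- k%:Z); rewrite IH0 IH1 mulr0 add0r.
Qed.

Section ConwayPolynomials.
Variables (A : comUnitRingType) (z : A).

Lemma conwayC_pred p : conwayC z (p - 1) = conwayC z (p + 1) - z * conwayC z p.
Proof. by rewrite conwayC_rec [RHS]addrC addKr. Qed.

Lemma signzD1 p : (-1 : A) ^ (p + 1) = - (-1) ^ p.
Proof. by rewrite exprzDr ?unitrN1 // expr1z mulrN1. Qed.

Lemma signzB1 p : (-1 : A) ^ (p - 1) = - (-1) ^ p.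
Proof. by rewrite -[in RHS](subrK 1 p) signzD1 opprK. Qed.

Lemma conwayC_opp p : conwayC z (- p) = - (-1) ^ p * conwayC z p.
Proof.
apply/eqP; rewrite mulNr -addr_eq0; apply/eqP; move: p.
apply: (@recurrence_eq0 _ (- z)) => [q||].
- rewrite signzD1 signzB1 opprD opprB [1 - q]addrC (conwayC_rec z q).
  by rewrite conwayC_pred; ring.
- by rewrite oppr0 conwayC0 mulr0 addr0.
- by rewrite /conwayC /= expr1z; ring.
Qed.

Section Relations.
Variables (n : nat) (w : int).
Implicit Type f : 'I_n -> A.

(** The difference of the two sides is a solution of the recurrence with [-z]
   that vanishes at [kappa = 0] and [kappa = 2]; since [z] is invertible it
   vanishes at [kappa = 1] too, hence everywhere. *)
Lemma relK_of_relA_relB f : z \is a GRing.unit ->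
  relA z w f -> relB z w f -> forall kappa, relK z w f kappa.
Proof.
move=> z_unit Af Bf kappa; rewrite /relK; apply/eqP; rewrite -subr_eq0; apply/eqP.
pose G k := \sum_(j < n) conwayC z ((2 * j)%:Z - 1 - k) * f j
            - (-1) ^ k * conwayC z (k + 2 + w - n%:Z).
have recG k : G (k + 1) = - z * G k + G (k - 1).
  rewrite /G signzD1 signzB1.
  have -> : k + 1 + 2 + w - n%:Z = (k + 2 + w - n%:Z) + 1 by lia.
  have -> : k - 1 + 2 + w - n%:Z = (k + 2 + w - n%:Z) - 1 by lia.
  under eq_bigr => j _.
    have -> : (2 * j)%:Z - 1 - (k + 1) = ((2 * j)%:Z - 1 - k) - 1 by lia.
    rewrite conwayC_pred mulrBl -mulrA; over.
  under [X in _ = _ + (X - _)]eq_bigr => j _.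
    have -> : (2 * j)%:Z - 1 - (k - 1) = ((2 * j)%:Z - 1 - k) + 1 by lia.
    over.
  rewrite sumrB -mulr_sumr (conwayC_rec z (k + 2 + w - n%:Z)); ring.
have G0 : G 0 = 0.
  rewrite /G mul1r add0r -Bf; under eq_bigr do rewrite subr0.
  by rewrite subrr.
have G2 : G (1 + 1) = 0.
  rewrite /G signzD1 expr1z opprK mul1r -[1 + 1 + 2]/(4 : int) -Af.
  apply/eqP; rewrite subr_eq0; apply/eqP; apply: eq_bigr => j _.
  by congr (conwayC z _ * _); lia.
rewrite -/(G kappa); apply: (@recurrence_eq0 A (- z)) => //.
have := recG 1; rewrite subrr G0 addr0 G2 => zG1.
by apply/(mulrI z_unit)/oppr_inj; rewrite -mulNr -zG1 mulr0 oppr0.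
Qed.

(** On the first two members of the family the coefficients of the left-hand
   sides are [C_(-3) = 1 + z^2] and [C_(-1) = C_1 = 1], a matrix of determinant
   [z^2]; the other members can be taken to be zero. *)
Lemma relation_values_surj a b : z \is a GRing.unit -> (1 < n)%N ->
  exists f, \sum_(j < n) conwayC z ((2 * j)%:Z - 3) * f j = a
         /\ \sum_(j < n) conwayC z ((2 * j)%:Z - 1) * f j = b.
Proof.
case: n => [|[|m]] // z_unit _.
pose f0 := z ^- 2 * (a - b).
exists (fun j => if val j is k.+1 then (if k is 0%N then b - f0 else 0) else f0).
have tail (F : 'I_m -> A) : \sum_(i < m) F i * 0 = 0.
  by apply: big1 => i _; rewrite mulr0.
rewrite !big_ord_recl /= !tail.
rewrite /conwayC /= !(mulr0, mulr1, subr0, addr0, sub0r, add0r).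
have eq_a : z * z * f0 = a - b.
  by rewrite -expr2 /f0 mulrA mulrV ?mul1r // unitrX.
split; last by rewrite !mul1r addrC subrK.
by rewrite mulrN opprK mulrDl eq_a !mul1r; ring.
Qed.

Lemma relA_relB_independent : z \is a GRing.unit -> (1 < n)%N ->
  (exists f, relA z w f /\ ~ relB z w f) /\
  (exists f, relB z w f /\ ~ relA z w f).
Proof.
move=> z_unit n_gt1; split.
- have [f [Af Bf]] := relation_values_surj (conwayC z (4 + w - n%:Z))
    (conwayC z (2 + w - n%:Z) + 1) z_unit n_gt1.
  exists f; split=> //; rewrite /relB Bf => /eqP.
  by rewrite -subr_eq0 addrC addKr oner_eq0.
- have [f [Af Bf]] := relation_values_surj (conwayC z (4 + w - n%:Z) + 1)
    (conwayC z (2 + w - n%:Z)) z_unit n_gt1.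
  exists f; split=> //; rewrite /relA Af => /eqP.
  by rewrite -subr_eq0 addrC addKr oner_eq0.
Qed.

End Relations.
End ConwayPolynomials.

(** * Reduction of positive words by braid relations *)

(** The relations of the positive braid monoid, on words in the generators
   numbered from 0. *)
Inductive braid_move : seq nat -> seq nat -> Prop :=
| BraidFar x y i j of (i.+1 < j)%N :
    braid_move (x ++ [:: i; j] ++ y) (x ++ [:: j; i] ++ y)
| BraidAdjacent x y i :
    braid_move (x ++ [:: i; i.+1; i] ++ y) (x ++ [:: i.+1; i; i.+1] ++ y).

Definition braid_equiv : seq nat -> seq nat -> Prop :=
  clos_refl_sym_trans _ braid_move.

Definition has_square (u : seq nat) : Prop :=
  exists x i y, u = x ++ [:: i; i] ++ y.

Lemma braid_equiv_refl u : braid_equiv u u.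
Proof. exact: rst_refl. Qed.

Lemma braid_equiv_sym u v : braid_equiv u v -> braid_equiv v u.
Proof. exact: rst_sym. Qed.

Lemma braid_equiv_trans v u w :
  braid_equiv u v -> braid_equiv v w -> braid_equiv u w.
Proof. exact: rst_trans. Qed.

Lemma braid_equiv_cat x y u v :
  braid_equiv u v -> braid_equiv (x ++ u ++ y) (x ++ v ++ y).
Proof.
elim=> {u v} [u v|u|u v _|u v w _ IH1 _ IH2].
- case=> [x' y' i j lt_ij|x' y' i]; apply: rst_step.
    have := BraidFar (x ++ x') (y' ++ y) lt_ij.
    by rewrite -!catA.
  have := BraidAdjacent (x ++ x') (y' ++ y) i.
  by rewrite -!catA.
- exact: rst_refl.
- exact: rst_sym.
- exact: rst_trans IH1 IH2.
Qed.

Lemma braid_equiv_size u v : braid_equiv u v -> size u = size v.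
Proof.
elim=> {u v} [u v [x y i j _|x y i]|u|u v _|u v w _ -> _ ->] //;
  by rewrite !size_cat.
Qed.

Lemma braid_equiv_all (p : pred nat) u v : braid_equiv u v -> all p u = all p v.
Proof.
elim=> {u v} [u v [x y i j _|x y i]|u|u v _|u v w _ -> _ ->] //.
  by rewrite !all_cat /= !andbT [p i && _]andbC.
by rewrite !all_cat /=; case: (p i); case: (p i.+1).
Qed.

Lemma braid_equiv_far k b :
  all (fun i => i.+1 < k)%N b -> braid_equiv (k :: b) (b ++ [:: k]).
Proof.
elim: b => [|i b IHb] /=; first by move=> _; exact: braid_equiv_refl.
case/andP=> lt_ik far_b; apply: (@braid_equiv_trans (i :: k :: b)).
  by apply/rst_sym/rst_step; apply: (BraidFar [::] b).
by have := braid_equiv_cat [:: i] [::] (IHb far_b); rewrite !cats0.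
Qed.

Lemma split_count_gt0 (T : eqType) (k : T) w : (0 < count_mem k w)%N ->
  exists a c, [/\ w = a ++ k :: c, k \notin a & count_mem k w = (count_mem k c).+1].
Proof.
rewrite -has_count has_pred1 => w_k; move: (w_k); rewrite -index_mem => lt_k.
exists (take (index k w) w), (drop (index k w).+1 w).
have notin : k \notin take (index k w) w by rewrite in_take // ltnn.
have eq_w : w = take (index k w) w ++ k :: drop (index k w).+1 w.
  by rewrite -{2}(nth_index k w_k) -drop_nth // cat_take_drop.
split=> //; rewrite {1}eq_w count_cat /= eqxx add1n.
by rewrite (count_memPn notin) add0n.
Qed.

Lemma all_lt_neq k b :
  all (fun i => i < k.+1)%N b -> k \notin b -> all (fun i => i < k)%N b.
Proof.
move=> le_b nk; apply/allP=> i i_b; have := allP le_b i i_b.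
by rewrite ltnS leq_eqVlt => /predU1P[eq_ik|//]; rewrite -eq_ik i_b in nk.
Qed.

(** Between two consecutive occurrences of the last generator, a word in the
   smaller ones reduces by induction to contain a square or at most one letter
   [k]; in the latter case the two occurrences are brought next to each other,
   or around that letter, where the braid relation merges them into one. *)
Lemma braid_equiv_reduce k u : all (fun i => i < k.+1)%N u ->
  exists v, braid_equiv u v /\ (has_square v \/ count_mem k v <= 1)%N.
Proof.
elim: k u => [|k IHk] u.
  case: u => [|[|i] [|[|j] u]] //= _.
  - by exists [::]; split; [exact: braid_equiv_refl | right].
  - by exists [:: 0%N]; split; [exact: braid_equiv_refl | right].
  - exists [:: 0, 0 & u]%N; split; first exact: braid_equiv_refl.
    by left; exists [::], 0%N, u.
have [N] := ubnP (count_mem k.+1 u); elim: N u => // N IHN u le_N le_u.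
have [le1|gt1] := leqP (count_mem k.+1 u) 1.
  by exists u; split; [exact: braid_equiv_refl | right].
have [a [r [eq_u ka cnt_u]]] := split_count_gt0 (ltnW gt1).
rewrite cnt_u ltnS in gt1.
have [b [c [eq_r kb cnt_r]]] := split_count_gt0 gt1.
have := le_u; rewrite {1}eq_u eq_r all_cat /= all_cat /=.
case/and5P=> le_a ltk le_b _ le_c.
have {}le_b := all_lt_neq le_b kb.
have [b' [eq_b]] := IHk b le_b.
rewrite (braid_equiv_all _ eq_b) in le_b.
(* From here on, the word between the two occurrences is the reduced one. *)
have eq_bb' : braid_equiv (a ++ k.+1 :: b ++ k.+1 :: c)
                          (a ++ k.+1 :: b' ++ k.+1 :: c).
  by have := braid_equiv_cat (rcons a k.+1) (k.+1 :: c) eq_b; rewrite !cat_rcons.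
case=> [[x [i [y eq_b']]]|].
  exists (a ++ k.+1 :: b' ++ k.+1 :: c); split; first by rewrite eq_u eq_r.
  left.
  exists (a ++ k.+1 :: x), i, (y ++ k.+1 :: c).
  by rewrite eq_b' -!catA /= -?catA.
rewrite leq_eqVlt => /predU1P[cnt1|].
  have [b1 [b2 [def_b' kb1 cnt2]]] : exists a c, [/\ b' = a ++ k :: c,
      k \notin a & count_mem k b' = (count_mem k c).+1].
    by apply: split_count_gt0; rewrite cnt1.
  have kb2 : k \notin b2.
    by rewrite -has_pred1 has_count; rewrite cnt1 in cnt2; case: cnt2 => <-.
  move: le_b; rewrite def_b' all_cat /= => /and3P[le_b1 _ le_b2].
  have far_b1 : all (fun i => i.+1 < k.+1)%N b1 by exact: all_lt_neq kb1.
  have far_b2 : all (fun i => i.+1 < k.+1)%N b2 by exact: all_lt_neq kb2.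
  set u' := a ++ b1 ++ [:: k; k.+1; k] ++ b2 ++ c.
  have eq_u' : braid_equiv u u'.
    rewrite eq_u eq_r; apply: braid_equiv_trans eq_bb' _; rewrite def_b'.
    apply: (@braid_equiv_trans (a ++ (b1 ++ [:: k.+1]) ++ k :: b2 ++ k.+1 :: c)).
      have := braid_equiv_cat a (k :: b2 ++ k.+1 :: c) (braid_equiv_far far_b1).
      by rewrite -!catA.
    apply: (@braid_equiv_trans
      (a ++ b1 ++ [:: k.+1; k; k.+1] ++ b2 ++ c)).
      have := braid_equiv_cat (a ++ b1 ++ [:: k.+1; k]) c
        (braid_equiv_sym (braid_equiv_far far_b2)).
      by rewrite -!catA.
    apply/rst_sym/rst_step; have := BraidAdjacent (a ++ b1) (b2 ++ c) k.
    by rewrite -!catA.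
  have cnt_u' : (count_mem k.+1 u' < count_mem k.+1 u)%N.
    rewrite cnt_u cnt_r /u' !count_cat /= eqxx.
    rewrite (ltn_eqF (ltnSn k)) (count_memPn ka).
    have no_k b0 : all (fun i => i < k)%N b0 -> count_mem k.+1 b0 = 0%N.
      move=> lt0; apply/count_memPn/negP=> /(allP lt0) /=.
      by rewrite ltnNge leqnSn.
    by rewrite (no_k b1) ?(no_k b2).
  have [||v [eq_v good_v]] := IHN u'.
  - exact: leq_trans cnt_u' le_N.
  - by rewrite -(braid_equiv_all _ eq_u').
  by exists v; split=> //; exact: braid_equiv_trans eq_u' eq_v.
rewrite ltnS leqn0 => /eqP/count_memPn kb'.
have far_b' : all (fun i => i.+1 < k.+1)%N b' by apply: all_lt_neq kb'.
exists (a ++ b' ++ [:: k.+1; k.+1] ++ c); split.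
  rewrite eq_u eq_r; apply: braid_equiv_trans eq_bb' _.
  have := braid_equiv_cat a (k.+1 :: c) (braid_equiv_far far_b').
  by rewrite -!catA.
by left; exists (a ++ b'), k.+1, c; rewrite -catA.
Qed.

(** * Isotopies of tangles and stabilization of closed braids *)

Lemma run_cat d1 d2 s : run (d1 ++ d2) s = obind (run d2) (run d1 s).
Proof. by elim: d1 s => //= l d1 IHd s; case: (run1 l s). Qed.

Lemma run_cat_some d1 d2 s t :
  run d1 s = Some t -> run (d1 ++ d2) s = run d2 t.
Proof. by rewrite run_cat => ->. Qed.

Definition shift_layer (k : nat) (l : layer) : layer := ((k + l.1)%N, l.2).

Lemma run_shift p d s :
  run (map (shift_layer (size p)) d) (p ++ s) = omap (cat p) (run d s).
Proof.
have run1_shift l t : run1 (shift_layer (size p) l) (p ++ t)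
    = omap (cat p) (run1 l t).
  have nth_shift i : nth false (p ++ t) (size p + i) = nth false t i.
    by rewrite nth_cat ltnNge leq_addr addKn.
  have take_shift i : take (size p + i) (p ++ t) = p ++ take i t.
    by rewrite take_cat ltnNge leq_addr addKn.
  have drop_shift i : drop (size p + i) (p ++ t) = drop i t.
    by rewrite drop_cat ltnNge leq_addr addKn.
  case: l => i [b||c]; rewrite /shift_layer /= size_cat
    -?[(_ + i).+2]addnS -?[(_ + i).+1]addnS -?addnS.
  - by rewrite leq_add2l; case: ifP => // _; rewrite take_shift drop_shift -catA.
  - rewrite leq_add2l !nth_shift; case: ifP => //= _.
    by rewrite take_shift drop_shift -catA.
  - rewrite leq_add2l !nth_shift; case: ifP => //= _.
    by rewrite take_shift drop_shift -catA.
have run_cons l d' t : run (l :: d') t = obind (run d') (run1 l t) by [].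
elim: d s => // l d IHd s; rewrite map_cons !run_cons run1_shift.
by case: (run1 l s) => //= t; rewrite IHd.
Qed.

(** The layers [l] and [r], running from the slice [s] to the slice [t], may be
   exchanged inside any link diagram.  Keeping track of the slices makes the
   relation compatible with stacking, since moves are only allowed between
   valid diagrams. *)
Definition tangle_isotopic (s t : slice) (l r : seq layer) : Prop :=
  [/\ run l s = Some t, run r s = Some t &
      forall d1 d2, run d1 [::] = Some s -> run d2 t = Some [::] ->
        isotopic (d1 ++ l ++ d2) (d1 ++ r ++ d2)].

Lemma tangle_isotopic_refl s t l :
  run l s = Some t -> tangle_isotopic s t l l.
Proof. by move=> run_l; split=> // *; apply: rst_refl. Qed.

Lemma tangle_isotopic_sym s t l r :
  tangle_isotopic s t l r -> tangle_isotopic s t r l.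
Proof. by case=> run_l run_r iso; split=> // *; apply/rst_sym/iso. Qed.

Lemma tangle_isotopic_trans m s t l r :
  tangle_isotopic s t l m -> tangle_isotopic s t m r -> tangle_isotopic s t l r.
Proof.
case=> run_l _ iso1 [_ run_r iso2]; split=> // d1 d2 run1 run2.
by apply: rst_trans (iso1 _ _ run1 run2) (iso2 _ _ run1 run2).
Qed.

Lemma tangle_isotopic_cat s t u l1 r1 l2 r2 :
  tangle_isotopic s t l1 r1 -> tangle_isotopic t u l2 r2 ->
  tangle_isotopic s u (l1 ++ l2) (r1 ++ r2).
Proof.
case=> run_l1 run_r1 iso1 [run_l2 run_r2 iso2].
split=> [||d1 d2 run1 run2].
- by rewrite (run_cat_some _ run_l1).
- by rewrite (run_cat_some _ run_r1).
apply: (@rst_trans _ _ _ (d1 ++ r1 ++ l2 ++ d2)).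
  by rewrite -catA; apply: iso1; rewrite ?(run_cat_some _ run_l2).
have := iso2 (d1 ++ r1) d2; rewrite -!catA; apply=> //.
by rewrite (run_cat_some _ run1).
Qed.

Lemma tangle_isotopic_catl s t u l r1 r2 : run l s = Some t ->
  tangle_isotopic t u r1 r2 -> tangle_isotopic s u (l ++ r1) (l ++ r2).
Proof. by move/tangle_isotopic_refl; apply: tangle_isotopic_cat. Qed.

Lemma tangle_isotopic_catr s t u l1 l2 r : run r t = Some u ->
  tangle_isotopic s t l1 l2 -> tangle_isotopic s u (l1 ++ r) (l2 ++ r).
Proof.
move=> run_r iso_l.
exact: tangle_isotopic_cat iso_l (tangle_isotopic_refl run_r).
Qed.

Lemma tangle_isotopic_move s t p l r q : local_move l r ->
  run (p ++ l ++ q) s = Some t -> run (p ++ r ++ q) s = Some t ->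
  tangle_isotopic s t (p ++ l ++ q) (p ++ r ++ q).
Proof.
move=> lr run_l run_r; split=> // d1 d2 run1 run2; apply: rst_step.
have diag d : run d s = Some t -> link_diagram (d1 ++ d ++ d2).
  by move=> run_d; rewrite /link_diagram (run_cat_some _ run1) (run_cat_some _ run_d).
have := @DiagramMove (d1 ++ p) (q ++ d2) l r lr.
by rewrite -!catA; apply; [have := diag _ run_l | have := diag _ run_r]; rewrite -!catA.
Qed.

Definition crossings (w : seq (nat * bool)) : seq layer :=
  [seq (x.1, Cross x.2) | x <- w].

Definition on_strands (n : nat) (w : seq (nat * bool)) : bool :=
  all (fun x => x.1.+1 < n)%N w.

Definition cups n : seq layer := [seq (k, Cup true) | k <- iota 0 n].
Definition caps n : seq layer := [seq (k, Cap) | k <- rev (iota 0 n)].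

Definition word_closure n w := cups n ++ crossings w ++ caps n.

(** The slice of a closed braid between its minima and its maxima. *)
Definition closure_slice n : slice := nseq n true ++ nseq n false.

Lemma cups_rec n : cups n.+1 = cups n ++ [:: (n, Cup true)].
Proof. by rewrite /cups -addn1 iotaD map_cat add0n. Qed.

Lemma caps_rec n : caps n.+1 = (n, Cap) :: caps n.
Proof. by rewrite /caps -addn1 iotaD rev_cat map_cat add0n. Qed.

Lemma crossings_cat u v : crossings (u ++ v) = crossings u ++ crossings v.
Proof. exact: map_cat. Qed.

Lemma closure_slice_rec n :
  closure_slice n.+1 = nseq n true ++ [:: true; false] ++ nseq n false.
Proof. by rewrite /closure_slice -addn1 nseqD -catA addn1. Qed.

Lemma run_from d p s t i : size p = i ->
  run d s = Some t -> run (map (shift_layer i) d) (p ++ s) = Some (p ++ t).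
Proof. by move=> <- run_d; rewrite run_shift run_d. Qed.

Lemma run_last_cup n :
  run [:: (n, Cup true)] (closure_slice n) = Some (closure_slice n.+1).
Proof.
rewrite closure_slice_rec -[n in (n, _)]addn0.
by apply: (run_from (size_nseq n true) (d := [:: (0, Cup true)]%N));
  rewrite /= take0 drop0.
Qed.

Lemma run_last_cap n :
  run [:: (n, Cap)] (closure_slice n.+1) = Some (closure_slice n).
Proof.
rewrite closure_slice_rec -[n in (n, _)]addn0.
by apply: (run_from (size_nseq n true) (d := [:: (0, Cap)]%N));
  rewrite /= drop0.
Qed.

Lemma run_cups n : run (cups n) [::] = Some (closure_slice n).
Proof.
by elim: n => // n IHn; rewrite cups_rec (run_cat_some _ IHn) run_last_cup.
Qed.

Lemma run_caps n : run (caps n) (closure_slice n) = Some [::].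
Proof.
elim: n => // n IHn.
by rewrite caps_rec -cat1s (run_cat_some _ (run_last_cap n)).
Qed.

Lemma nth_closure_slice n i : (i < n)%N -> nth false (closure_slice n) i = true.
Proof. by move=> lt_in; rewrite nth_cat size_nseq lt_in nth_nseq lt_in. Qed.

Lemma run_crossings n w : on_strands n w ->
  run (crossings w) (closure_slice n) = Some (closure_slice n).
Proof.
elim: w => //= [[i c] w] IHw /andP[/= lt_in /IHw run_w].
have lt_size : (i.+1 < size (closure_slice n))%N.
  by rewrite size_cat !size_nseq ltn_addr.
rewrite lt_size /= -[RHS]run_w; congr (run _ _).
have := cat_take_drop i (closure_slice n).
rewrite (drop_nth false (ltnW lt_size)) (drop_nth false lt_size).
by rewrite !nth_closure_slice ?(ltnW lt_in).
Qed.

Lemma word_closure_diagram n w : on_strands n w -> link_diagram (word_closure n w).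
Proof.
move=> on_w; rewrite /link_diagram /word_closure (run_cat_some _ (run_cups n)).
by rewrite (run_cat_some _ (run_crossings on_w)) run_caps.
Qed.

(** Both branches of the last minimum lie to the right of all the strands
   crossed in [a], so the minimum can be raised past [a], layer by layer. *)
Lemma slide_last_cup m a : on_strands m a ->
  tangle_isotopic (closure_slice m) (closure_slice m.+1)
    ((m, Cup true) :: crossings a) (crossings a ++ [:: (m, Cup true)]).
Proof.
elim: a => [|[j c] a IHa] /=; first by move=> _; apply/tangle_isotopic_refl/run_last_cup.
case/andP=> /= lt_j on_a; have {IHa} iso_a := IHa on_a.
have on_j : on_strands m [:: (j, c)] by rewrite /on_strands /= lt_j.
have on_jS : on_strands m.+1 [:: (j, c)] by rewrite /on_strands /= ltnW.
have on_aS : on_strands m.+1 a by apply: sub_all on_a => x /ltnW.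
have run_j := run_crossings on_j.
apply: (@tangle_isotopic_trans ((j, Cross c) :: (m, Cup true) :: crossings a)).
  apply: (tangle_isotopic_catr (l1 := [:: (m, Cup true); (j, Cross c)])
            (l2 := [:: (j, Cross c); (m, Cup true)]) (run_crossings on_aS)).
  apply: tangle_isotopic_sym.
  apply: (@tangle_isotopic_move _ _ [::] [:: _; _] [:: _; _] [::]).
  - have := move_exchange j (m - j.+2) (Cross c) (Cup true).
    by rewrite /= !addn2 subnKC.
  - by rewrite -cat1s (run_cat_some _ run_j) run_last_cup.
  - by rewrite -cat1s (run_cat_some _ (run_last_cup m)) (run_crossings on_jS).
by apply: (tangle_isotopic_catl (l := [:: (j, Cross c)]) run_j iso_a).
Qed.

Lemma slide_last_cap m a : on_strands m a ->
  tangle_isotopic (closure_slice m.+1) (closure_slice m)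
    ((m, Cap) :: crossings a) (crossings a ++ [:: (m, Cap)]).
Proof.
elim: a => [|[j c] a IHa] /=; first by move=> _; apply/tangle_isotopic_refl/run_last_cap.
case/andP=> /= lt_j on_a; have {IHa} iso_a := IHa on_a.
have on_j : on_strands m [:: (j, c)] by rewrite /on_strands /= lt_j.
have on_jS : on_strands m.+1 [:: (j, c)] by rewrite /on_strands /= ltnW.
have run_j := run_crossings on_jS.
apply: (@tangle_isotopic_trans ((j, Cross c) :: (m, Cap) :: crossings a)).
  apply: (tangle_isotopic_catr (l1 := [:: (m, Cap); (j, Cross c)])
            (l2 := [:: (j, Cross c); (m, Cap)]) (run_crossings on_a)).
  apply: tangle_isotopic_sym.
  apply: (@tangle_isotopic_move _ _ [::] [:: _; _] [:: _; _] [::]).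
  - have := move_exchange j (m - j.+2) (Cross c) Cap.
    by rewrite /= !addn2 subnKC.
  - by rewrite -cat1s (run_cat_some _ run_j) run_last_cap.
  - by rewrite -cat1s (run_cat_some _ (run_last_cap m)) (run_crossings on_j).
by apply: (tangle_isotopic_catl (l := [:: (j, Cross c)]) run_j iso_a).
Qed.

(** The last minimum and maximum now enclose a single crossing: sliding the
   crossing to the other leg of the minimum puts it under the maximum, where
   the first Reidemeister move removes it and leaves a zigzag. *)
Lemma untwist_last_strand i c :
  tangle_isotopic (closure_slice i.+1) (closure_slice i.+1)
    [:: (i.+1, Cup true); (i, Cross c); (i.+1, Cap)] [::].
Proof.
set s := closure_slice i.+1.
have run_local d d' : map (shift_layer i) d = d' ->
    run d (true :: nseq i.+1 false) = Some (true :: nseq i.+1 false) ->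
    run d' s = Some s.
  rewrite /s closure_slice_rec => <-.
  exact: (run_from (s := true :: nseq i.+1 false) (size_nseq i true)).
have run_clasp : run [:: (i.+1, Cup true); (i, Cross c); (i.+1, Cap)] s = Some s.
  apply: (run_local [:: (1, Cup true); (0, Cross c); (1, Cap)]%N);
    by rewrite /= ?drop0 // /shift_layer /= addn0 addn1.
have run_curl :
    run [:: (i, Cup true); (i.+1, Cross (~~ c)); (i.+1, Cap)] s = Some s.
  apply: (run_local [:: (0, Cup true); (1, Cross (~~ c)); (1, Cap)]%N);
    by rewrite /= ?drop0 // /shift_layer /= addn0 addn1.
have run_bend : run [:: (i, Cup true); (i.+1, Cap)] s = Some s.
  apply: (run_local [:: (0, Cup true); (1, Cap)]%N);
    by rewrite /= ?drop0 // /shift_layer /= addn0 addn1.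
apply: tangle_isotopic_trans (tangle_isotopic_trans _ _).
- have := move_slide_cup i true (~~ c); rewrite negbK => slide.
  exact/tangle_isotopic_sym/(tangle_isotopic_move (p := [::]) (q := [:: _]) slide).
- exact: (tangle_isotopic_move (p := [:: _]) (q := [::]) (move_R1_cap i.+1 _)).
- exact: (tangle_isotopic_move (p := [::]) (q := [::]) (move_zigzag_left i true)).
Qed.

Lemma on_strands_cat n a b :
  on_strands n (a ++ b) = on_strands n a && on_strands n b.
Proof. exact: all_cat. Qed.

Lemma on_strandsS n a : on_strands n a -> on_strands n.+1 a.
Proof. by apply: sub_all => x /ltnW. Qed.

Lemma word_closure_isotopic n u v :
  tangle_isotopic (closure_slice n) (closure_slice n) (crossings u) (crossings v) ->
  isotopic (word_closure n u) (word_closure n v).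
Proof. by case=> _ _ iso; apply: iso (run_cups n) (run_caps n). Qed.

(** The Markov move, for a last generator that may occur anywhere in the word:
   the last minimum slides up to the crossing and the last maximum slides down
   to it. *)
Lemma stabilization i c a b : on_strands i.+1 a -> on_strands i.+1 b ->
  isotopic (word_closure i.+2 (a ++ (i, c) :: b)) (word_closure i.+1 (a ++ b)).
Proof.
move=> on_a on_b; have run_a := run_crossings on_a; have run_b := run_crossings on_b.
have on_i : on_strands i.+2 [:: (i, c)] by rewrite /on_strands /= ltnSn.
have slide := tangle_isotopic_cat (slide_last_cup on_a)
  (tangle_isotopic_catl (run_crossings on_i)
    (tangle_isotopic_sym (slide_last_cap on_b))).
have untwist := tangle_isotopic_catl run_a
  (tangle_isotopic_catr run_b (untwist_last_strand i c)).
rewrite -[X in tangle_isotopic _ _ _ X]catA in slide.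
have [_ _ iso] := tangle_isotopic_trans slide untwist.
have := iso (cups i.+1) (caps i.+1) (run_cups _) (run_caps _).
rewrite /word_closure (cups_rec i.+1) (caps_rec i.+1) !crossings_cat /=.
by rewrite -!catA /= -!catA.
Qed.

(** * Skein induction over closed braids *)

Definition positive_word (u : seq nat) : seq (nat * bool) :=
  [seq (i, true) | i <- u].

Lemma on_strands_positive n u :
  on_strands n (positive_word u) = all (fun i => i.+1 < n)%N u.
Proof. by rewrite /on_strands all_map. Qed.

Lemma isotopic_word_move n x y l r : on_strands n (x ++ l ++ y) ->
  on_strands n (x ++ r ++ y) ->
  local_move (crossings l) (crossings r) ->
  isotopic (word_closure n (x ++ l ++ y)) (word_closure n (x ++ r ++ y)).
Proof.
move=> /run_crossings run_l /run_crossings run_r lr.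
apply: word_closure_isotopic; move: run_l run_r; rewrite !crossings_cat.
exact: tangle_isotopic_move.
Qed.

Lemma isotopic_braid_equiv n u v :
  braid_equiv u v -> on_strands n (positive_word u) ->
  isotopic (word_closure n (positive_word u)) (word_closure n (positive_word v)).
Proof.
move=> eq_uv; have := eq_uv.
elim: eq_uv => {u v} [u v step|u|u v eq_uv IH|u v w eq_uv IH1 eq_vw IH2] equiv on_u.
- have on_v : on_strands n (positive_word v).
    by move: on_u; rewrite !on_strands_positive (braid_equiv_all _ equiv).
  case: step on_u on_v {equiv} => [x y i j lt_ij|x y i];
    rewrite /positive_word !map_cat => on_u on_v; apply: isotopic_word_move => //=.
    have := move_exchange i (j - i.+2) (Cross true) (Cross true).
    by rewrite /= !addn2 subnKC.
  exact: move_R3.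
- exact: rst_refl.
- apply/rst_sym/IH => //; rewrite on_strands_positive.
  by rewrite (braid_equiv_all _ eq_uv) -on_strands_positive.
- apply: rst_trans (IH1 eq_uv on_u) (IH2 eq_vw _).
  by rewrite on_strands_positive -(braid_equiv_all _ eq_uv) -on_strands_positive.
Qed.

(** What is known of the set of diagrams whose Homflypt polynomial is 1 at the
   root: each member of a skein triple of closed braids is in the set as soon
   as the other two are. *)
Record skein_closed (X : seq layer -> Prop) : Prop := SkeinClosed {
  skein_closed_isotopy : forall d d', link_diagram d -> link_diagram d' ->
    isotopic d d' -> X d -> X d';
  skein_closed_circle : X circle;
  skein_closed_flip : forall n x i b y, on_strands n (x ++ (i, b) :: y) ->
    X (word_closure n (x ++ y)) -> X (word_closure n (x ++ (i, b) :: y)) ->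
    X (word_closure n (x ++ (i, ~~ b) :: y));
  skein_closed_smooth : forall n x i y, on_strands n (x ++ (i, true) :: y) ->
    X (word_closure n (x ++ (i, true) :: y)) ->
    X (word_closure n (x ++ (i, false) :: y)) -> X (word_closure n (x ++ y))
}.

Section SkeinClosed.
Variable X : seq layer -> Prop.
Hypothesis X_closed : skein_closed X.

Lemma skein_closed_isotopic_closure m n u v : on_strands m u -> on_strands n v ->
  isotopic (word_closure m u) (word_closure n v) ->
  X (word_closure n v) -> X (word_closure m u).
Proof.
move=> /word_closure_diagram on_u /word_closure_diagram on_v iso.
exact/(skein_closed_isotopy X_closed)/rst_sym.
Qed.

(** Signs do not matter once the shorter words are settled, since the
   smoothings of a word are shorter; [p] is the part already treated. *)
Lemma skein_closed_signs n p u v :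
    (forall w, on_strands n w -> size w < size (p ++ u) ->
      X (word_closure n w))%N ->
  unzip1 u = unzip1 v -> on_strands n (p ++ u) ->
  X (word_closure n (p ++ u)) -> X (word_closure n (p ++ v)).
Proof.
elim: u p v => [|[i b] u IHu] p [|[j c] v] //= Xshort [<-] eq_uv on_u Xu.
have Xflip : X (word_closure n (p ++ (i, c) :: u)).
  have [<-//|neq_bc] := eqVneq b c.
  have -> : c = ~~ b by case: b c neq_bc {Xu on_u Xshort} => [] [].
  apply: (skein_closed_flip X_closed) => //; apply: Xshort.
    by move: on_u; rewrite !on_strands_cat /= => /and3P[-> _ ->].
  by rewrite !size_cat /= addnS.
have on_c : on_strands n (p ++ (i, c) :: u).
  by move: on_u; rewrite !on_strands_cat.
rewrite -cat_rcons; apply: IHu; rewrite ?cat_rcons // => w on_w.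
by move=> lt_w; apply: Xshort => //; rewrite !size_cat in lt_w *.
Qed.

(** Changing the sign of one of the two crossings lets them cancel. *)
Lemma skein_closed_square n x i y :
    (forall w, on_strands n w -> size w < size (x ++ [:: i; i] ++ y) ->
      X (word_closure n w))%N ->
  on_strands n (positive_word (x ++ [:: i; i] ++ y)) ->
  X (word_closure n (positive_word (x ++ [:: i; i] ++ y))).
Proof.
move=> Xshort; rewrite /positive_word !map_cat /= -!/(positive_word _) => on_w.
have on_xy : on_strands n (positive_word x ++ positive_word y).
  by move: on_w; rewrite !on_strands_cat /= => /and4P[-> _ _ ->].
have on_pos : on_strands n (positive_word x ++ (i, true) :: positive_word y).
  by move: on_w; rewrite !on_strands_cat /= => /and4P[-> -> _ ->].
have on_cancel : on_strands n
    (positive_word x ++ [:: (i, true); (i, false)] ++ positive_word y).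
  by move: on_w; rewrite /on_strands /= !all_cat.
have Xcancel : X (word_closure n
    (positive_word x ++ [:: (i, true); (i, false)] ++ positive_word y)).
  apply: (skein_closed_isotopic_closure on_cancel on_xy).
    exact: (isotopic_word_move (r := [::]) on_cancel on_xy (move_R2 i true)).
  by apply: Xshort; rewrite // !size_cat !size_map !addnS ltnS leqnSn.
rewrite -cat_rcons.
apply: (skein_closed_flip X_closed (b := false)); rewrite ?cat_rcons //.
by apply: Xshort; rewrite // !size_cat /= !size_map !addnS.
Qed.

(** Induction on the number of strands, then on the length of the word: the
   word is made positive, reduced as a word in the Coxeter generators, and then
   loses a strand by stabilization. *)
Theorem skein_closed_word_closure n w :
  on_strands n.+1 w -> X (word_closure n.+1 w).
Proof.
elim: n w => [|n IHn] w; first by case: w => // _; exact: skein_closed_circle.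
have Xstab c a b : on_strands n.+1 a -> on_strands n.+1 b ->
    X (word_closure n.+2 (a ++ (n, c) :: b)).
  move=> on_a on_b.
  have on_ab : on_strands n.+1 (a ++ b) by rewrite on_strands_cat on_a.
  apply: (skein_closed_isotopic_closure _ on_ab
            (stabilization c on_a on_b) (IHn _ on_ab)).
  by rewrite /on_strands all_cat /= ltnSn; apply/andP; split; exact: on_strandsS.
have [N] := ubnP (size w); elim: N w => // N IHN w le_N on_w.
have Xshort v : on_strands n.+2 v -> (size v < size w)%N -> X (word_closure n.+2 v).
  by move=> on_v lt_v; apply: IHN => //; apply: leq_trans lt_v _.
set u := unzip1 w.
have size_u : size (positive_word u) = size w by rewrite !size_map.
have on_u : on_strands n.+2 (positive_word u).
  by rewrite on_strands_positive all_map.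
suff Xu : X (word_closure n.+2 (positive_word u)).
  apply: (skein_closed_signs (p := [::]) _ _ on_u Xu); rewrite /= ?size_u //.
  by rewrite /unzip1 -map_comp map_id.
have [v [eq_uv good_v]] : exists v,
    braid_equiv u v /\ (has_square v \/ count_mem n v <= 1)%N.
  by apply: braid_equiv_reduce; have := on_u; rewrite on_strands_positive.
have on_v : on_strands n.+2 (positive_word v).
  by rewrite on_strands_positive -(braid_equiv_all _ eq_uv) -on_strands_positive.
apply: (skein_closed_isotopic_closure on_u on_v (isotopic_braid_equiv eq_uv on_u)).
case: good_v => [[x [i [y def_v]]]|].
  rewrite def_v in on_v eq_uv *; apply: skein_closed_square => // t on_t lt_t.
  by apply: Xshort; rewrite // -size_u size_map (braid_equiv_size eq_uv).
have lower a : all (fun i => i.+1 < n.+2)%N a -> n \notin a ->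
    on_strands n.+1 (positive_word a).
  by rewrite on_strands_positive => le_a na; apply: all_lt_neq.
rewrite leq_eqVlt => /predU1P[cnt1|].
  have [|a [b [def_v na cnt_v]]] := @split_count_gt0 _ n v; first by rewrite cnt1.
  have nb : n \notin b.
    by rewrite -has_pred1 has_count; rewrite cnt1 in cnt_v; case: cnt_v => <-.
  move: on_v; rewrite on_strands_positive def_v all_cat /= => /and3P[on_a _ on_b].
  by rewrite /positive_word map_cat /=; apply: Xstab; apply: lower.
(* The last strand is split off: the closure is the smoothing of the two closures
   obtained by joining this strand to the others by a crossing of either sign. *)
rewrite ltnS leqn0 => /eqP/count_memPn nv.
rewrite on_strands_positive in on_v; have on_v' := lower v on_v nv.
rewrite -[positive_word v]cats0.
apply: (skein_closed_smooth X_closed (i := n)); try exact: Xstab.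
by rewrite on_strands_cat on_strandsS //= ltnSn.
Qed.

End SkeinClosed.

(** * The Homflypt polynomial at the roots of v^2 + z v - 1 *)

Definition skein_poly : {poly Qz} := 'X^2 + zz *: 'X - 1.

(** Membership in the ideal of Q(z)[v, 1/v] generated by [v^2 + z v - 1], that
   is, vanishing at the two roots of this polynomial.  The factor [vv ^+ m] clears
   the negative powers of [v], and it is nonzero at the roots. *)
Definition vanishes_at_root (y : Qzv) : Prop :=
  exists (m : nat) (q : {poly Qz}), y * vv ^+ m = tofrac (skein_poly * q).

Lemma zz_neq0 : zz != 0.
Proof. by rewrite tofrac_eq0 polyX_eq0. Qed.

Lemma vv_neq0 : vv != 0.
Proof. by rewrite tofrac_eq0 polyX_eq0. Qed.

Lemma of_Qz_zz_neq0 : of_Qz zz != 0.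
Proof. by rewrite tofrac_eq0 polyC_eq0 zz_neq0. Qed.

Lemma vanishes_at_rootD x y :
  vanishes_at_root x -> vanishes_at_root y -> vanishes_at_root (x + y).
Proof.
move=> [m [p def_x]] [n [q def_y]]; exists (m + n)%N, (p * 'X^n + q * 'X^m).
rewrite mulrDr !mulrA tofracD !(tofracM (_ * _)) -def_x -def_y !tofracXn.
by rewrite exprD mulrDl -!mulrA [X in y * X]mulrC.
Qed.

Lemma vanishes_at_rootM p y :
  vanishes_at_root y -> vanishes_at_root (tofrac p * y).
Proof.
case=> m [q def_y]; exists m, (p * q).
by rewrite -mulrA def_y -tofracM mulrCA.
Qed.

Lemma vanishes_at_root_divv y :
  vanishes_at_root y -> vanishes_at_root (vv^-1 * y).
Proof.
case=> m [q def_y]; exists m.+1, q.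
by rewrite -def_y exprS mulrACA mulVf ?vv_neq0 // mul1r.
Qed.

Lemma vanishes_at_root_gen : vanishes_at_root (vv * of_Qz zz + vv ^+ 2 - 1).
Proof.
exists 0%N, 1; rewrite expr0 [LHS]mulr1 [skein_poly * 1]mulr1 /skein_poly.
rewrite -mul_polyC tofracD tofracN tofrac1 tofracD tofracXn tofracM.
by rewrite [vv * _]mulrC [_ + vv ^+ 2]addrC.
Qed.

(** With [g = 0] this says that the skein relation is an affine relation with
   invertible coefficients, which can be solved for each of its terms. *)
Lemma affine_skein_solve (F : fieldType) (v z p0 pm : F) : v != 0 -> z != 0 ->
  let pp := v * z * p0 + v ^+ 2 * pm in let g := v * z + v ^+ 2 - 1 in
  [/\ pp - 1 = v * (v * (pm - 1)) + (v * (z * (p0 - 1)) + g),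
      pm - 1 = v^-1 * (v^-1 * (pp - 1 - (v * (z * (p0 - 1)) + g))) &
      p0 - 1 = z^-1 * (v^-1 * (pp - 1 - (v * (v * (pm - 1)) + g)))].
Proof.
move=> v0 z0 pp g; rewrite /pp /g.
by split; [ring | field | field; rewrite v0 z0].
Qed.

Section HomflyptAtRoot.
Variable P : seq layer -> Qzv.
Hypothesis homP : homflypt P.

Lemma homflypt_word_skein n x i y : on_strands n (x ++ (i, true) :: y) ->
  P (word_closure n (x ++ (i, true) :: y)) =
    vv * of_Qz zz * P (word_closure n (x ++ y))
    + vv ^+ 2 * P (word_closure n (x ++ (i, false) :: y)).
Proof.
move=> on_w; have [on_x lt_i _] : [/\ on_strands n x, i.+1 < n & on_strands n y]%N.
  by move: on_w; rewrite on_strands_cat => /and3P[].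
have run_x : run (cups n ++ crossings x) [::] = Some (closure_slice n).
  by rewrite (run_cat_some _ (run_cups n)) run_crossings.
have closureE c : word_closure n (x ++ (i, c) :: y) =
    (cups n ++ crossings x) ++ [:: (i, Cross c)] ++ (crossings y ++ caps n).
  by rewrite /word_closure !crossings_cat -!catA.
have := homflypt_skein homP (d2 := crossings y ++ caps n) (i := i) run_x.
rewrite /positive_type /smoothing !nth_closure_slice ?(ltnW lt_i) //= eqxx -!closureE.
move=> ->; last exact: word_closure_diagram.
by rewrite /word_closure !crossings_cat -!catA.
Qed.

Lemma homflypt_root_skein_closed :
  skein_closed (fun d => vanishes_at_root (P d - 1)).
Proof.
have v0 := vv_neq0; have z0 := of_Qz_zz_neq0.
have mulv y : vanishes_at_root y -> vanishes_at_root (vv * y).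
  exact: vanishes_at_rootM.
have mulz a y : vanishes_at_root y -> vanishes_at_root (of_Qz a * y).
  exact: vanishes_at_rootM.
have opp y : vanishes_at_root y -> vanishes_at_root (- y).
  by move/(vanishes_at_rootM (-1)); rewrite rmorphN1 mulN1r.
have gen := vanishes_at_root_gen.
have zV : of_Qz (zz^-1) = (of_Qz zz)^-1.
  apply: (mulfI z0); rewrite mulfV // /of_Qz -rmorphM -polyCM mulfV ?zz_neq0 //.
split.
- by move=> d d' dd dd' iso; rewrite (homflypt_isotopy homP dd dd' iso).
- rewrite (homflypt_unknot homP) subrr; exists 0%N, 0.
  by rewrite [LHS]mul0r [skein_poly * 0]mulr0 tofrac0.
- move=> n x i b y on_w X0.
  have skein : P (word_closure n (x ++ (i, true) :: y)) =
    vv * of_Qz zz * P (word_closure n (x ++ y))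
    + vv ^+ 2 * P (word_closure n (x ++ (i, false) :: y)).
    by apply: homflypt_word_skein; move: on_w; rewrite /on_strands !all_cat.
  have [eq_pos eq_neg _] := affine_skein_solve (P (word_closure n (x ++ y)))
    (P (word_closure n (x ++ (i, false) :: y))) v0 z0.
  have X0' := vanishes_at_rootD (mulv _ (mulz zz _ X0)) gen.
  case: b {on_w} => /= Xb.
    rewrite eq_neg -skein; do 2!apply: vanishes_at_root_divv.
    exact/vanishes_at_rootD/opp.
  rewrite skein eq_pos; apply: (vanishes_at_rootD _ X0'); exact/mulv/mulv.
- move=> n x i y /homflypt_word_skein skein Xt Xf.
  have [_ _ ->] := affine_skein_solve (P (word_closure n (x ++ y)))
    (P (word_closure n (x ++ (i, false) :: y))) v0 z0.
  rewrite -skein -zV; apply/mulz/vanishes_at_root_divv/vanishes_at_rootD => //.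
  by apply/opp/vanishes_at_rootD => //; apply/mulv/mulv.
Qed.

Lemma homflypt_closure_at_root n (beta : braid_word n) :
  (0 < n)%N -> vanishes_at_root (P (braid_closure beta) - 1).
Proof.
case: n beta => // n beta _.
have -> : braid_closure beta = word_closure n.+1 [seq (val x.1, x.2) | x <- beta].
  by rewrite /word_closure /crossings -map_comp.
apply: (skein_closed_word_closure homflypt_root_skein_closed).
by apply/allP=> _ /mapP[[i c] _ ->] /=; have := ltn_ord i.
Qed.

End HomflyptAtRoot.

(** The coefficient of [u] in [u^c p(1/u)], where [u^2 = 1 + z u]: the powers of
   [u] are given by [u^p = C_p u + C_(p-1)]. *)
Definition conway_form (c : int) (p : {poly Qz}) : Qz :=
  \sum_(i < size p) p`_i * conwayC zz (c - i%:Z).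

Section ConwayForm.
Implicit Types (c : int) (p q : {poly Qz}).

Lemma conway_form_widen N c p : (size p <= N)%N ->
  conway_form c p = \sum_(i < N) p`_i * conwayC zz (c - i%:Z).
Proof.
move=> le_p; rewrite /conway_form.
rewrite (big_ord_widen N (fun i => p`_i * conwayC zz (c - i%:Z))) // big_mkcond.
by apply: eq_bigr => i _; case: ltnP => // /(nth_default 0) ->; rewrite mul0r.
Qed.

Lemma conway_formD c p q :
  conway_form c (p + q) = conway_form c p + conway_form c q.
Proof.
pose N := maxn (size p) (size q).
rewrite (@conway_form_widen N) ?size_polyD // (@conway_form_widen N) ?leq_maxl //.
rewrite (@conway_form_widen N) ?leq_maxr // -big_split.
by apply: eq_bigr => i _; rewrite coefD mulrDl.
Qed.

Lemma conway_formZ c a p : conway_form c (a *: p) = a * conway_form c p.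
Proof.
rewrite (@conway_form_widen (size p)) ?size_scale_leq // mulr_sumr.
by apply: eq_bigr => i _; rewrite coefZ mulrA.
Qed.

Lemma conway_formXM c p : conway_form c ('X * p) = conway_form (c - 1) p.
Proof.
rewrite (@conway_form_widen (size p).+1); last first.
  by rewrite (leq_trans (size_polyMleq _ _)) // size_polyX.
rewrite big_ord_recl coefXM mul0r add0r; apply: eq_bigr => i _.
by rewrite coefXM /= /bump /= add1n -addn1 PoszD opprD addrA addrAC.
Qed.

Lemma conway_formXnM c k p : conway_form c ('X^k * p) = conway_form (c - k%:Z) p.
Proof.
elim: k c => [|k IHk] c; first by rewrite mul1r subr0.
by rewrite exprS -mulrA conway_formXM IHk -addn1 PoszD opprD addrA addrAC.
Qed.

Lemma conway_form1 c : conway_form c 1 = conwayC zz c.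
Proof. by rewrite /conway_form size_poly1 big_ord1 coef1 mul1r subr0. Qed.

Lemma conway_formXn c k : conway_form c 'X^k = conwayC zz (c - k%:Z).
Proof. by rewrite -['X^k]mulr1 conway_formXnM conway_form1. Qed.

Lemma conway_formX c : conway_form c 'X = conwayC zz (c - 1).
Proof. exact: (conway_formXn c 1). Qed.

Lemma conway_formN c p : conway_form c (- p) = - conway_form c p.
Proof. by rewrite -scaleN1r conway_formZ mulN1r. Qed.

Lemma conway_form_sum c (I : Type) (r : seq I) (F : I -> {poly Qz}) :
  conway_form c (\sum_(i <- r) F i) = \sum_(i <- r) conway_form c (F i).
Proof.
apply: (big_morph _ (conway_formD c)).
by rewrite /conway_form size_poly0 big_ord0.
Qed.

Lemma conway_form_skein c q : conway_form c (skein_poly * q) = 0.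
Proof.
rewrite -[q]coefK poly_def mulr_sumr conway_form_sum big1 // => i _.
rewrite -scalerAr conway_formZ [skein_poly * _]mulrC conway_formXnM.
rewrite !conway_formD conway_formN conway_formZ !conway_formXn conway_form1.
set k := c - i%:Z.
have -> : k - 2 = k - 1 - 1 by lia.
by rewrite conway_formX conwayC_pred subrK subrK subrr mulr0.
Qed.
End ConwayForm.

(** The congruence of the Homflypt polynomial with 1, read through the linear
   forms that annihilate the multiples of [skein_poly]. *)
Lemma laurent_MFW_conway P n (beta : braid_word n) (h : 'I_n -> Qz) :
  homflypt P -> (0 < n)%N -> laurent_MFW P beta h -> forall c,
  \sum_(j < n) conwayC zz (c - (2 * j)%:Z) * h j =
    conwayC zz (c + (exponent_sum beta - n%:Z + 1)).
Proof.
move=> homP n_gt0 [_ defP] c.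
have [m [q]] := homflypt_closure_at_root homP beta n_gt0; rewrite {}defP.
set e := exponent_sum beta - n%:Z + 1.
(* Negative powers of [v] are cleared by writing [e] as a difference. *)
have [a [b def_e]] : exists a b : nat, e = a%:Z - b%:Z.
  case: e => k; first by exists k, 0%N; rewrite subr0.
  by exists 0%N, k.+1; rewrite NegzE sub0r.
pose H : {poly Qz} := \sum_(j < n) h j *: 'X^(2 * j).
have -> : \sum_(j < n) of_Qz (h j) * vv ^+ (2 * j) = tofrac H.
  by rewrite rmorph_sum; apply: eq_bigr => j _; rewrite -mul_polyC rmorphM rmorphXn.
move=> root_eq.
have poly_eq : ('X^a * H - 'X^b) * 'X^m = skein_poly * ('X^b * q).
  apply/eqP; rewrite mulrCA -tofrac_eq (tofracM _ (skein_poly * q)) -root_eq.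
  rewrite tofracM tofracB tofracM !tofracXn -/vv mulrA; apply/eqP.
  congr (_ * _); rewrite mulrBr [vv ^+ b * 1]mulr1 mulrA; congr (_ * _ - _).
  rewrite def_e expfzDr ?vv_neq0 // -exprnN -exprnP mulrCA mulfV ?expf_neq0 ?vv_neq0 //.
  by rewrite [_ * 1]mulr1.
have := conway_form_skein (c + m%:Z + a%:Z) ('X^b * q).
rewrite -poly_eq mulrC conway_formXnM conway_formD conway_formN.
rewrite conway_formXnM conway_formXn.
have -> : c + m%:Z + a%:Z - m%:Z - a%:Z = c by lia.
have -> : c + m%:Z + a%:Z - m%:Z - b%:Z = c + e by lia.
move/eqP; rewrite subr_eq0 conway_form_sum => /eqP <-.
by apply: eq_bigr => j _; rewrite conway_formZ conway_formXn mulrC.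
Qed.

(** * The relations satisfied by the Laurent MFW polynomials *)

Lemma laurent_MFW_relations P n (beta : braid_word n) (h : 'I_n -> Qz) :
  homflypt P -> (0 < n)%N -> laurent_MFW P beta h ->
  relA zz (exponent_sum beta) h /\ relB zz (exponent_sum beta) h.
Proof.
move=> homP n_gt0 MFW; have conway_eq := laurent_MFW_conway homP n_gt0 MFW.
have sign_even (j : nat) : (-1 : Qz) ^ (2 * j)%:Z = 1.
  by rewrite -exprnP exprM sqrrN !expr1n.
split.
- transitivity (\sum_(j < n) conwayC zz (3 - (2 * j)%:Z) * h j).
    apply: eq_bigr => j _; rewrite -opprB conwayC_opp; congr (_ * _).
    have -> : 3 - (2 * j)%:Z = - (2 * j)%:Z + 1 + 1 + 1 by lia.
    by rewrite !signzD1 -invr_expz sign_even invr1 !opprK mul1r.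
  by rewrite conway_eq; congr (conwayC zz _); lia.
- transitivity (\sum_(j < n) conwayC zz (1 - (2 * j)%:Z) * h j).
    apply: eq_bigr => j _; rewrite -opprB conwayC_opp; congr (_ * _).
    have -> : 1 - (2 * j)%:Z = - (2 * j)%:Z + 1 by lia.
    by rewrite !signzD1 -invr_expz sign_even invr1 !opprK mul1r.
  by rewrite conway_eq; congr (conwayC zz _); lia.
Qed.

Theorem theorem2p2 :
  (forall (P : seq layer -> Qzv) (n : nat) (beta : braid_word n)
          (h : 'I_n -> Qz),
     homflypt P -> (0 < n)%N -> laurent_MFW P beta h ->
     relA zz (exponent_sum beta) h /\ relB zz (exponent_sum beta) h)
  /\
  (forall (A : comUnitRingType) (z : A) (n : nat) (w : int),
     z \is a GRing.unit -> (1 < n)%N ->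
     (exists f : 'I_n -> A, relA z w f /\ ~ relB z w f)
     /\ (exists f : 'I_n -> A, relB z w f /\ ~ relA z w f))
  /\
  (forall (A : comUnitRingType) (z : A) (n : nat) (w : int) (f : 'I_n -> A),
     z \is a GRing.unit -> (0 < n)%N ->
     relA z w f -> relB z w f ->
     forall kappa : int, relK z w f kappa).
Proof.
split; first exact: laurent_MFW_relations.
split=> [A z n w|A z n w f z_unit _]; first exact: relA_relB_independent.
exact: relK_of_relA_relB.
Qed.
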